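(* Let $k\ge 1$ and $\epsilon>0$ be constants. Let $(C_n)$ be a family of circuits where $C_n$ computes $\mathrm{CLIQUE}$ on $n$-vertex graphs and has uniform orientation $\beta\in\{0,1\}^{\binom n2}$, and suppose there is a set $U$ of vertices with $|U|\ge\log^{k+\epsilon}n$ such that $\beta_e=0$ for every edge $e$ with both endpoints in $U$. Then $C_n$ must have depth $\omega(\log^k n)$.
   Context: Circuits have $\land,\lor$ gates of fan-in at most two and $\neg$ gates. Input variables are indexed by edges of the complete graph on $n$ vertices. A Boolean function $f:\{0,1\}^N\to\{0,1\}$ has orientation $\beta\in\{0,1\}^N$ if there is a monotone $h$ with $f(x)=h(x,x\oplus\beta)$ for all $x$. A circuit has uniform orientation $\beta$ if $\beta$ is an orientation of the function computed at every gate. $\mathrm{CLIQUE}=\mathrm{CLIQUE}(n,n/2)$. *)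

(* Defs.v *)
From mathcomp Require Import all_boot all_order all_algebra.
From mathcomp Require Import all_classical all_reals all_analysis.

Set Implicit Arguments.
Unset Strict Implicit.
Unset Printing Implicit Defensive.

Import Order.TTheory GRing.Theory Num.Theory.
Import numFieldNormedType.Exports.
Local Open Scope classical_set_scope.

Definition cube (I : finType) := {ffun I -> bool}.

Definition monotone (I : finType) (h : cube I -> bool) : Prop :=
  forall x y : cube I, (forall i, x i -> y i) -> h x -> h y.

(* The point (x, x (+) beta) of {0,1}^(2N), indexed by I + I. *)
Definition oriented_pair (I : finType) (beta x : cube I) : cube (I + I)%type :=
  [ffun s => match s with inl i => x i | inr i => x i (+) beta i end].

Definition has_orientation (I : finType) (beta : cube I) (f : cube I -> bool) :
    Prop :=
  exists2 h : cube (I + I)%type -> bool,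
    monotone h & forall x, f x = h (oriented_pair beta x).

(* A circuit is a directed acyclic graph, given as the list of its nodes in a  *)
(* topological order; wires are the positions in that list of the nodes they   *)
(* come from. A conjunction (disjunction) of fan-in 0 is the constant true     *)
(* (false).                                                                    *)
Inductive gate (I : Type) : Type :=
| GVar of I
| GAnd of seq nat
| GOr of seq nat
| GNot of nat.
Arguments GAnd {I}.
Arguments GOr {I}.
Arguments GNot {I}.

Definition gate_args (I : Type) (g : gate I) : seq nat :=
  match g with
  | GVar _ => [::]
  | GAnd s | GOr s => s
  | GNot j => [:: j]
  end.

Fixpoint wf_gates (I : Type) (m : nat) (gs : seq (gate I)) : bool :=
  if gs is g :: gs' then
    [&& size (gate_args g) <= 2, all (fun j => j < m) (gate_args g)
      & wf_gates m.+1 gs']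
  else true.

Record circuit (I : finType) := Circuit {
  gates : seq (gate I);
  output : nat;
  _ : wf_gates 0 gates;
  _ : output < size gates
}.

Definition gate_eval (I : finType) (x : cube I) (vs : seq bool) (g : gate I) :
    bool :=
  match g with
  | GVar i => x i
  | GAnd s => all (nth false vs) s
  | GOr s => has (nth false vs) s
  | GNot j => ~~ nth false vs j
  end.

Definition node_values (I : finType) (C : circuit I) (x : cube I) : seq bool :=
  foldl (fun vs g => rcons vs (gate_eval x vs g)) [::] (gates C).

Definition node_fun (I : finType) (C : circuit I) (j : nat) (x : cube I) : bool :=
  nth false (node_values C x) j.

Definition computes (I : finType) (C : circuit I) (f : cube I -> bool) : Prop :=
  forall x, node_fun C (output C) x = f x.

(* The length, in wires, of a longest directed path ending at each node. *)
Definition node_depths (I : finType) (C : circuit I) : seq nat :=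
  foldl (fun ds g => rcons ds (\max_(j <- gate_args g) (nth 0 ds j).+1))
    [::] (gates C).

Definition depth (I : finType) (C : circuit I) : nat :=
  nth 0 (node_depths C) (output C).

Definition uniform_orientation (I : finType) (C : circuit I) (beta : cube I) :
    Prop :=
  forall j, j < size (gates C) -> has_orientation beta (node_fun C j).

Definition edge (n : nat) : finType := {e : {set 'I_n} | #|e| == 2}.

Definition clique (n m : nat) (x : cube (edge n)) : bool :=
  [exists S : {set 'I_n},
    (#|S| == m) && [forall e : edge n, (val e \subset S) ==> x e]].

(* n/2 is rounded down when n is odd. *)
Definition CLIQUE (n : nat) : cube (edge n) -> bool := @clique n n./2.

Definition log2 (R : realType) (n : nat) : R := (ln n%:R / ln 2)%R.

Definition littleomega (R : realType) (f g : nat -> R) : Prop :=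
  (g : nat -> R^o) =o_\oo (f : nat -> R^o).

(* Main.v *)
Require Import Defs.
From mathcomp Require Import all_boot all_order all_algebra zify.

(* Setting the edges outside a subset of [U] to constants turns [C n] into a   *)
(* circuit for a smaller clique function in which every gate computes a        *)
(* monotone function, so that negation gates are constant. It remains to bound *)
(* the depth of such circuits below by m / polylog(m), for a suitable clique   *)
(* size in graphs on m vertices.                                               *)
(*   The clique problem encodes satisfiability of the Tseitin parity           *)
(* constraints of the de Bruijn graph with N = 2 ^ r vertices, composed with   *)
(* the gadget [y_e == Some x_e] on each edge e: the clique player holds x, the *)
(* other one holds y, and the graph vertices are the local assignments of x at *)
(* the N constraints. An edge that separates the two inputs exhibits a         *)
(* violated constraint. The lower bound is Razborov's rank argument: let       *)
(*   A(x, y) = \sum_(|W| < N / 2) +- \prod_(e notin cut W) (-1) ^ z_e,         *)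
(* where z_e is the value of the gadget. Then A has full rank b ^ (2 * N),     *)
(* while on a rectangle that violates the constraint at v the terms of W and   *)
(* W (+) {v} cancel; this leaves only the balanced W, whose cuts have at least *)
(* (N - 1) / r edges, hence a rank that is smaller by a factor exponential in  *)
(* N / r.                                                                      *)

Set Implicit Arguments.
Unset Strict Implicit.
Unset Printing Implicit Defensive.

Import Order.TTheory GRing.Theory Num.Theory.

(** * Circuits and rectangle measures *)

(** Quantitatively, [measure_depth] compares two ranks of the Tseitin matrix. On the whole rectangle
    the rank is at least [b ^ (2 * N)] ([tseitin_rank_full]); where a single input edge separates
    the inputs it is at most [2 * K] ([tseitin_rank_violated]). By [db_cut_balanced] the surviving
    cuts have at least g edges with g r > N - 2, and for b = 32 r [rank_gap] gives 2^g K <= b^(2N).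
    Hence g <= depth + 1, which is [clique_depth].

    The de Bruijn graph has degree 4, so there are only m = N b^4 = 2^r (32 r)^4 local assignments,
    and the depth bound, about 2^r / r, is m up to polylogarithmic factors. With m just below log^(k
    + eps) n, the spare eps absorbs these factors ([powR_le_depth]). *)

Lemma foldl_rconsP (T G : Type) (t0 : T) (g0 : G) (F : seq T -> G -> T)
    (gs : seq G) :
  let ts := foldl (fun ts g => rcons ts (F ts g)) [::] gs in
  size ts = size gs /\
  forall j, j < size gs -> nth t0 ts j = F (take j ts) (nth g0 gs j).
Proof.
elim/last_ind: gs => [|gs g [IHsz IH]] //=.
rewrite foldl_rcons /=; set ts := foldl _ _ _ in IHsz IH *.
split=> [|j]; first by rewrite !size_rcons IHsz.
rewrite size_rcons ltnS leq_eqVlt => /predU1P[->|ltj].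
  by rewrite -IHsz nth_rcons ltnn eqxx -cats1 take_size_cat // IHsz nth_rcons
             ltnn eqxx.
rewrite !nth_rcons IHsz ltj (IH _ ltj) -cats1 takel_cat // IHsz.
exact: ltnW.
Qed.

Lemma wf_gatesP (I : Type) (g0 : gate I) (gs : seq (gate I)) m j :
  wf_gates m gs -> j < size gs ->
  size (gate_args (nth g0 gs j)) <= 2 /\
  all (fun i => i < m + j) (gate_args (nth g0 gs j)).
Proof.
elim: gs m j => [|g gs IH] //= m [|j] /and3P[sz lt wf] ltj /=.
  by rewrite addn0.
by have := IH _ _ wf ltj; rewrite addSnnS.
Qed.

Section Nodes.
Variables (I : finType) (C : circuit I).

Definition node_gate j : gate I := nth (GAnd [::]) (gates C) j.
Definition node_depth j : nat := nth 0 (node_depths C) j.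

Lemma node_args j : j < size (gates C) ->
  size (gate_args (node_gate j)) <= 2 /\
  {in gate_args (node_gate j), forall i, i < j}.
Proof.
rewrite /node_gate; case: C => gs o wf lto /= ltj.
have [sz lt] := wf_gatesP (GAnd [::]) wf ltj; split=> // i; exact: (allP lt).
Qed.

Lemma node_funE j x : j < size (gates C) ->
  node_fun C j x = match node_gate j with
    | GVar i => x i
    | GAnd s => all (fun i => node_fun C i x) s
    | GOr s => has (fun i => node_fun C i x) s
    | GNot i => ~~ node_fun C i x
    end.
Proof.
move=> ltj; have [_ lt] := node_args ltj.
have [_ /(_ j ltj)] := foldl_rconsP false (GAnd [::]) (gate_eval x) (gates C).
rewrite -/(node_values C x) /node_fun => ->; rewrite -/(node_gate j) /gate_eval.
case: (node_gate j) lt => //= [s|s|i] lt.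
- by apply: eq_in_all => i /lt ltij; rewrite nth_take.
- by apply: eq_in_has => i /lt ltij; rewrite nth_take.
- by rewrite nth_take // lt ?mem_head.
Qed.

Lemma node_depthE j : j < size (gates C) ->
  node_depth j = \max_(i <- gate_args (node_gate j)) (node_depth i).+1.
Proof.
move=> ltj; have [_ lt] := node_args ltj.
have [_ /(_ j ltj)] := foldl_rconsP 0 (GAnd [::])
  (fun ds g => \max_(i <- gate_args g) (nth 0 ds i).+1) (gates C).
rewrite -/(node_depths C) /node_depth => ->; rewrite -/(node_gate j).
by apply: eq_big_seq => i /lt ltij; rewrite nth_take.
Qed.

End Nodes.

(** This is where fan-in two enters: two arguments of depth at most D cost at most 2^D + 2^D = 2^(D
    + 1). *)
Lemma sum_exp2_max (d : nat -> nat) (s : seq nat) : size s <= 2 ->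
  \sum_(i <- s) 2 ^ d i <= 2 ^ \max_(i <- s) (d i).+1.
Proof.
case: s => [|i [|j []]] //= _; rewrite !(big_cons, big_nil) ?addn0 ?maxn0 //.
  by rewrite leq_exp2l.
rewrite maxnSS expnS mul2n -addnn.
by rewrite leq_add // leq_exp2l // ?leq_maxl ?leq_maxr.
Qed.

(* Karchmer-Wigderson/Razborov: a subadditive rectangle measure at most        *)
(* doubles at each gate. A negation contributes nothing: comparison with [bot] *)
(* forces it to be constant on the two families of inputs.                     *)
Section RectangleMeasure.
Variables (I : finType) (C : circuit I) (X Y : finType).
Variables (G : X -> cube I) (H : Y -> cube I) (bot : cube I).
Variables (mu : {set X} -> {set Y} -> nat) (K : nat).
Hypothesis mu0l : forall Q, mu set0 Q = 0.
Hypothesis mu0r : forall P, mu P set0 = 0.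
Hypothesis muDl : forall P Q P', mu P Q <= mu (P :&: P') Q + mu (P :\: P') Q.
Hypothesis muDr : forall P Q Q', mu P Q <= mu P (Q :&: Q') + mu P (Q :\: Q').
Hypothesis mu_var : forall i (P : {set X}) (Q : {set Y}), {in P, forall x, G x i} ->
  {in Q, forall y, ~~ H y i} -> mu P Q <= K.
Hypothesis botG : forall j x, j < size (gates C) ->
  node_fun C j bot -> node_fun C j (G x).
Hypothesis botH : forall j y, j < size (gates C) ->
  node_fun C j bot -> node_fun C j (H y).

Lemma measure_node j (P : {set X}) (Q : {set Y}) : j < size (gates C) ->
  {in P, forall x, node_fun C j (G x)} ->
  {in Q, forall y, ~~ node_fun C j (H y)} ->
  mu P Q <= 2 ^ node_depth C j * K.
Proof.
elim/ltn_ind: j P Q => j IH P Q ltj PT QF.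
have [sz lt] := node_args ltj.
rewrite node_depthE //.
have fE x := node_funE x ltj.
case gE: (node_gate C j) sz lt fE => [i|s|s|i] /= sz lt fE.
- rewrite big_nil mul1n; apply: (@mu_var i) => [x /PT|y /QF]; by rewrite fE.
- apply: leq_trans (leq_mul (sum_exp2_max (node_depth C) sz) (leqnn K)).
  have {}PT : {in P, forall x, all (fun i => node_fun C i (G x)) s}.
    by move=> x /PT; rewrite fE.
  have {}QF : {in Q, forall y, ~~ all (fun i => node_fun C i (H y)) s}.
    by move=> x /QF; rewrite fE.
  rewrite big_distrl /=.
  elim: s Q {sz gE fE} lt PT QF => [|i s IHs] Q lt PT QF.
    rewrite big_nil; suff -> : Q = set0 by rewrite mu0r.
    by apply/setP=> y; rewrite inE; apply/negP => /QF.
  (* Inputs of [Q] rejected by argument [i] are charged to [i]; the others must be rejected by a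
     later argument. *)
  rewrite big_cons; pose Q' := [set y | ~~ node_fun C i (H y)].
  have ltij : i < j by apply: lt; rewrite mem_head.
  apply: leq_trans (muDr P Q Q') _; apply: leq_add.
    apply: IH => // [|x /PT/= /andP[] //|y].
      exact: ltn_trans ltj.
    by rewrite !inE => /andP[].
  apply: IHs => [i' si'|x /PT/= /andP[] //|y].
    by apply: lt; rewrite inE si' orbT.
  by rewrite !inE negbK => /andP[fi /QF/=]; rewrite fi.
- apply: leq_trans (leq_mul (sum_exp2_max (node_depth C) sz) (leqnn K)).
  have {}PT : {in P, forall x, has (fun i => node_fun C i (G x)) s}.
    by move=> x /PT; rewrite fE.
  have {}QF : {in Q, forall y, ~~ has (fun i => node_fun C i (H y)) s}.
    by move=> x /QF; rewrite fE.
  rewrite big_distrl /=.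
  elim: s P {sz gE fE} lt PT QF => [|i s IHs] P lt PT QF.
    rewrite big_nil; suff -> : P = set0 by rewrite mu0l.
    by apply/setP=> y; rewrite inE; apply/negP => /PT.
  rewrite big_cons; pose P' := [set x | node_fun C i (G x)].
  have ltij : i < j by apply: lt; rewrite mem_head.
  apply: leq_trans (muDl P Q P') _; apply: leq_add.
    apply: IH => // [|x|y /QF/=].
    - exact: ltn_trans ltj.
    - by rewrite !inE => /andP[].
    - by rewrite negb_or => /andP[].
  apply: IHs => [i' si'|x|y /QF/=].
  - by apply: lt; rewrite inE si' orbT.
  - by rewrite !inE => /andP[fi /PT/=]; rewrite (negPf fi).
  - by rewrite negb_or => /andP[].
- have lti : i < size (gates C) by apply: ltn_trans ltj; rewrite lt ?mem_head.
  have [->|[x Px]] := set_0Vmem P; first by rewrite mu0l.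
  have [->|[y Qy]] := set_0Vmem Q; first by rewrite mu0r.
  (* Node [i] rejects [G x], hence [bot] by [botG]; so the negation accepts [bot], and then [H y] by
     [botH], against [QF]. *)
  have /negP[] := QF y Qy; apply: botH => //.
  by rewrite fE; apply: contra (botG x lti) _; have := PT x Px; rewrite fE.
Qed.

Lemma measure_depth :
  (forall x, node_fun C (output C) (G x)) ->
  (forall y, ~~ node_fun C (output C) (H y)) ->
  mu [set: X] [set: Y] <= 2 ^ depth C * K.
Proof.
by move=> GT HF; apply: measure_node => //; case: (C).
Qed.

End RectangleMeasure.

(** * Matrix rank as a rectangle measure *)

Section RankMeasure.
Local Open Scope ring_scope.
Variables (F : fieldType) (X Y : finType).

(** Entries outside the rectangle are zeroed rather than deleted: all restrictions keep one size,
    and splitting a rectangle becomes a sum of matrices. *)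
Definition rect_mx (f : X -> Y -> F) (P : {set X}) (Q : {set Y}) :
    'M[F]_(#|X|, #|Y|) :=
  \matrix_(i, j) (f (enum_val i) (enum_val j)
                    *+ ((enum_val i \in P) && (enum_val j \in Q))).

Definition rect_rank f P Q : nat := \rank (rect_mx f P Q).

Lemma rect_rank0l f Q : rect_rank f set0 Q = 0%N.
Proof.
by apply/eqP; rewrite mxrank_eq0; apply/eqP/matrixP => i j; rewrite !mxE inE.
Qed.

Lemma rect_rank0r f P : rect_rank f P set0 = 0%N.
Proof.
by apply/eqP; rewrite mxrank_eq0; apply/eqP/matrixP => i j;
   rewrite !mxE inE andbF.
Qed.

Lemma rect_rankDl f P Q P' :
  (rect_rank f P Q <= rect_rank f (P :&: P') Q + rect_rank f (P :\: P') Q)%N.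
Proof.
rewrite /rect_rank; suff -> : rect_mx f P Q =
    rect_mx f (P :&: P') Q + rect_mx f (P :\: P') Q by apply: mxrank_add.
apply/matrixP => i j; rewrite !mxE !inE -mulrnDr; congr (_ *+ _).
by case: (_ \in P); case: (_ \in P'); case: (_ \in Q).
Qed.

Lemma rect_rankDr f P Q Q' :
  (rect_rank f P Q <= rect_rank f P (Q :&: Q') + rect_rank f P (Q :\: Q'))%N.
Proof.
rewrite /rect_rank; suff -> : rect_mx f P Q =
    rect_mx f P (Q :&: Q') + rect_mx f P (Q :\: Q') by apply: mxrank_add.
apply/matrixP => i j; rewrite !mxE !inE -mulrnDr; congr (_ *+ _).
by case: (_ \in P); case: (_ \in Q'); case: (_ \in Q).
Qed.

Lemma eq_rect_rank f g (P : {set X}) (Q : {set Y}) :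
  {in P & Q, f =2 g} ->
  rect_rank f P Q = rect_rank g P Q.
Proof.
move=> fg; congr (\rank _); apply/matrixP => i j; rewrite !mxE.
by case: andP => [[Pi Qj]|_]; rewrite ?mulr0n // fg.
Qed.

Lemma rect_rank_sum (J : finType) (R : pred J) (f : J -> X -> Y -> F) P Q :
  (rect_rank (fun x y => \sum_(j | R j) f j x y)%R P Q
     <= \sum_(j | R j) rect_rank (f j) P Q)%N.
Proof.
rewrite /rect_rank.
have -> : rect_mx (fun x y => \sum_(j | R j) f j x y) P Q
    = \sum_(j | R j) rect_mx (f j) P Q.
  by apply/matrixP => i k; rewrite summxE !mxE -sumrMnl; apply: eq_bigr => j _;
     rewrite mxE.
elim/big_ind2: _ => [|A n B m An Bm|//]; first by rewrite mxrank0.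
exact: leq_trans (mxrank_add _ _) (leq_add An Bm).
Qed.

(** Rows depend on [x] only through [p x], so the matrix factors through dimension [#|Z|]. *)
Lemma rect_rank_factor (Z : finType) (p : X -> Z) (u : Z -> Y -> F) P Q :
  (rect_rank (fun x y => u (p x) y) P Q <= #|Z|)%N.
Proof.
pose B : 'M[F]_(#|X|, #|Z|) :=
  \matrix_(i, k) ((p (enum_val i) == enum_val k) && (enum_val i \in P))%:R.
pose D : 'M[F]_(#|Z|, #|Y|) :=
  \matrix_(k, j) (u (enum_val k) (enum_val j) *+ (enum_val j \in Q)).
suff -> : rect_rank (fun x y => u (p x) y) P Q = \rank (B *m D).
  exact: leq_trans (mxrankM_maxl _ _) (rank_leq_col _).
congr (\rank _); apply/matrixP => i j; rewrite !mxE.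
rewrite (bigD1 (enum_rank (p (enum_val i)))) //= !mxE enum_rankK eqxx /=.
rewrite big1 => [|k neq_k]; last first.
  rewrite !mxE; case: eqP => [E|_]; last by rewrite mul0r.
  by rewrite E enum_valK eqxx in neq_k.
by rewrite addr0; case: (_ \in P); case: (_ \in Q);
   rewrite ?mul1r ?mul0r ?mulr0n ?mulr1n ?mulr0.
Qed.

Lemma rect_rank_full (f : X -> Y -> F) (g : Y -> X -> F) (c : F) : c != 0 ->
  (forall x x', \sum_y f x y * g y x' = c *+ (x == x')) ->
  (#|X| <= rect_rank f [set: X] [set: Y])%N.
Proof.
move=> nz_c fg; pose B : 'M[F]_(#|Y|, #|X|) :=
  \matrix_(j, i) g (enum_val j) (enum_val i).
have : rect_mx f [set: X] [set: Y] *m B = c *: 1%:M.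
  apply/matrixP => i k; rewrite !mxE mulr_natr -(inj_eq enum_val_inj) -fg.
  rewrite [RHS](reindex_onto enum_val enum_rank) => [|y _]; last first.
    exact: enum_rankK.
  apply: eq_big => [j|j _]; first by rewrite enum_valK eqxx.
  by rewrite !mxE !inE mulr1n.
move=> /(congr1 mxrank); rewrite mxrank_scale_nz // mxrank1 => <-.
exact: mxrankM_maxl.
Qed.

End RankMeasure.

(** * The Tseitin matrix of a graph *)

Section Tseitin.
Local Open Scope ring_scope.
Variables (V E : finType) (src tgt : E -> V) (v0 : V).
Variables (d : nat) (inc : V -> 'I_d -> E).
Hypothesis inc_sum : forall v (z : E -> nat),
  (\sum_k z (inc v k) = \sum_(e | src e == v) z e + \sum_(e | tgt e == v) z e)%N.
Variable b : nat.

Notation X := {ffun E -> 'I_b}.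
Notation Y := {ffun E -> option 'I_b}.

(** At [y e = None] the gadget is false whatever [x] is; the dual matrix in [tseitin_rank_full] uses
    this as its reference value. *)
Definition hit (x : X) (y : Y) (e : E) : bool := y e == Some (x e).

Definition cut (W : {set V}) : {set E} :=
  [set e | (src e \in W) (+) (tgt e \in W)].

(** Up to the factor (-1)^(sum of all z_e), this is the product over v in [W] of the signs of the
    constraints, -1 meaning violated: the cut edges are those that count an odd number of times in
    the sum of the degrees over [W]. *)
Definition cut_sign (W : {set V}) (x : X) (y : Y) : rat :=
  (-1) ^+ (v0 \in W) * (-1) ^+ (\sum_(e in ~: cut W) hit x y e).

Definition tseitin_mx (x : X) (y : Y) : rat :=
  \sum_(W : {set V} | (2 * #|W| < #|V|)%N) cut_sign W x y.

Definition toggle (v : V) (W : {set V}) : {set V} :=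
  [set u | (u \in W) (+) (u == v)].

Lemma toggleK v : involutive (toggle v).
Proof. by move=> W; apply/setP=> u; rewrite !inE -addbA addbb addbF. Qed.

Lemma card_toggle v W : (#|toggle v W| <= #|W|.+1)%N.
Proof.
rewrite -addn1 -(cards1 v) (leq_trans _ (leq_card_setU _ _)) // subset_leq_card //.
by apply/subsetP => u; rewrite !inE; case: (_ \in _).
Qed.

(** Toggling [v] multiplies by the sign of the constraint at [v]. A loop at [v] is counted twice in
    the sum over [inc v] and is never cut, so it has no effect on either side. *)
Lemma cut_sign_toggle v W x y :
  cut_sign (toggle v W) x y =
  (-1) ^+ (v == v0) * (-1) ^+ (\sum_k hit x y (inc v k)) * cut_sign W x y.
Proof.
have signE (P : pred E) :
    (-1) ^+ (\sum_(e | P e) hit x y e) = \prod_e (-1) ^+ (P e && hit x y e) :> rat.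
  rewrite expr_sum [LHS]big_mkcond; apply: eq_bigr => e _.
  by case: (P e).
rewrite (inc_sum v (fun e => hit x y e)) exprD /cut_sign !signE inE.
rewrite -!big_split.
have -> : (-1) ^+ ((v0 \in W) (+) (v0 == v)) =
          (-1) ^+ (v == v0) * (-1) ^+ (v0 \in W) :> rat.
  by rewrite signr_addb mulrC [v0 == v]eq_sym.
rewrite -!mulrA; congr (_ * _); rewrite mulrCA; congr (_ * _).
rewrite -!big_split; apply: eq_bigr => e _; rewrite !inE /=.
rewrite -!signr_addb; congr (_ ^+ _).
by case: (src e \in W); case: (tgt e \in W); case: (src e == v);
   case: (tgt e == v); case: (hit x y e).
Qed.

(* On the inputs that violate the constraint at [v], the terms of [W] and of   *)
(* [toggle v W] cancel, so only the boundary of the family of small [W] is     *)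
(* left.                                                                       *)
Lemma tseitin_mx_violated v x y :
  odd (\sum_k hit x y (inc v k)) != (v == v0) ->
  tseitin_mx x y = \sum_(W : {set V} |
    (2 * #|W| < #|V|)%N && (#|V| <= 2 * #|toggle v W|)%N) cut_sign W x y.
Proof.
move=> viol; rewrite /tseitin_mx.
rewrite (bigID (fun W => (2 * #|toggle v W| < #|V|)%N)) /=.
under [X in _ + X]eq_bigl => W do rewrite -leqNgt.
set S := (X in X + _); suff -> : S = 0 by rewrite add0r.
suff : S = - S by move/eqP; rewrite -addr_eq0 -mulr2n mulrn_eq0 => /eqP.
rewrite {1}/S (reindex_inj (can_inj (toggleK v))) -sumrN.
apply: eq_big => [W|W _]; first by rewrite toggleK andbC.
rewrite cut_sign_toggle -[(-1) ^+ (\sum_k _)]signr_odd -signr_addb.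
by move: viol; case: (v == v0); case: (odd _); rewrite //= expr1 mulN1r.
Qed.

Variable g : nat.
Hypothesis cut_large : forall (W : {set V}) v, (2 * #|W| < #|V|)%N ->
  (#|V| <= 2 * #|toggle v W|)%N -> (g <= #|cut W|)%N.
Hypothesis cut_pos : forall W : {set V}, (2 * #|W| < #|V|)%N -> W != set0 ->
  cut W != set0.

(** A surviving term sees [x] only on the uncut edges S, so it factors through the b^|S|
    restrictions of [x] to S. *)
Lemma tseitin_rank_violated v (P : {set X}) (Q : {set Y}) :
  {in P & Q, forall x y, odd (\sum_k hit x y (inc v k)) != (v == v0)} ->
  (rect_rank tseitin_mx P Q <= \sum_(S : {set E} | (g <= #|~: S|)%N) b ^ #|S|)%N.
Proof.
move=> viol.
(* Grouping the [W] by their uncut edges [S] pays for each [S] only once. *)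
pose c (S : {set E}) : rat := \sum_(W : {set V} |
  [&& (2 * #|W| < #|V|)%N, (#|V| <= 2 * #|toggle v W|)%N & ~: cut W == S])
   (-1) ^+ (v0 \in W).
pose f S (x : X) (y : Y) : rat := c S * (-1) ^+ (\sum_(e in S) hit x y e).
rewrite (@eq_rect_rank _ _ _ _
  (fun x y => \sum_(S : {set E} | (g <= #|~: S|)%N) f S x y)); last first.
  move=> x y Px Qy; rewrite (tseitin_mx_violated (viol x y Px Qy)).
  rewrite (partition_big (fun W => ~: cut W)
            (fun S : {set E} => (g <= #|~: S|)%N)) => [|W /andP[lt le]]; last first.
    by rewrite setCK (cut_large lt le).
  apply: eq_bigr => S _; rewrite /f /c big_distrl /=.
  apply: eq_big => [W|W]; first by rewrite andbA.
  by case/andP=> _ /eqP <-.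
apply: leq_trans (rect_rank_sum _ _ _ _) _; apply: leq_sum => S _.
pose Z := {ffun {e : E | e \in S} -> 'I_b}.
have -> : (b ^ #|S| = #|Z|)%N by rewrite card_ffun card_ord card_sig.
pose p (x : X) : Z := [ffun e => x (val e)].
pose u (z : Z) (y : Y) : rat :=
  c S * (-1) ^+ (\sum_(e : {e : E | e \in S}) (y (val e) == Some (z e))).
rewrite (@eq_rect_rank _ _ _ _ (fun x y => u (p x) y)).
  exact: rect_rank_factor.
move=> x y _ _; rewrite /f /u; congr (_ * _ ^+ _).
rewrite (reindex_omap (val : {e | e \in S} -> E) insub) => [|e Se]; last first.
  by rewrite insubT.
apply: eq_big => [e|e _]; last by rewrite ffunE.
by rewrite (valP e) valK eqxx.
Qed.

(** The product of the [l (y e) (x e)] is a right inverse up to the scalar (-2)^|E|. Summing over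
    [y] turns each term into a product over edges in which a cut edge contributes 1 - 1 = 0; only
    the empty [W] remains, and it vanishes unless [x = x']. *)
Lemma tseitin_rank_full :
  (b ^ #|E| <= rect_rank tseitin_mx [set: X] [set: Y])%N.
Proof.
have -> : (b ^ #|E| = #|X|)%N by rewrite card_ffun card_ord.
pose l (o : option 'I_b) (i : 'I_b) : rat := (o == Some i)%:R - (o == None)%:R.
apply: (@rect_rank_full rat X Y _ (fun y x => \prod_e l (y e) (x e))
          ((-2) ^+ #|E|)) => [|x x']; first by rewrite expf_neq0.
have suml (h : option 'I_b -> rat) i : \sum_o h o * l o i = h (Some i) - h None.
  rewrite (bigD1 None) //= (bigD1 (Some i)) //= big1 => [|o /andP[oN oi]].
    have -> : l None i = -1 by rewrite /l eqxx sub0r.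
    have -> : l (Some i) i = 1 by rewrite /l eqxx subr0.
    by rewrite mulr1 mulrN1 addr0 addrC.
  by rewrite /l (negPf oN) (negPf oi) subr0 mulr0.
under eq_bigr => y _ do rewrite /tseitin_mx big_distrl /=.
rewrite exchange_big /= (bigD1 set0) ?cards0 ?muln0 /=; last first.
  by apply/card_gt0P; exists v0.
have signE W y : cut_sign W x y * (\prod_e l (y e) (x' e)) =
    (-1) ^+ (v0 \in W) * \prod_e
      ((-1) ^+ ((e \in ~: cut W) && (y e == Some (x e))) * l (y e) (x' e)).
  rewrite /cut_sign -mulrA; congr (_ * _); rewrite big_split /=; congr (_ * _).
  rewrite expr_sum [LHS]big_mkcond; apply: eq_bigr => e _.
  by case: (e \in _).
have sumE W : \sum_y cut_sign W x y * (\prod_e l (y e) (x' e)) =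
    (-1) ^+ (v0 \in W) * \prod_e ((-1) ^+ ((e \in ~: cut W) && (x' e == x e)) - 1).
  rewrite (eq_bigr _ (fun y _ => signE W y)).
  rewrite -big_distrr /=; congr (_ * _).
  rewrite -(bigA_distr_bigA (fun e o =>
    (-1) ^+ ((e \in ~: cut W) && (o == Some (x e))) * l o (x' e))) /=.
  apply: eq_bigr => e _; rewrite suml andbF expr0.
  by rewrite (inj_eq (@Some_inj _)).
rewrite [X in _ + X]big1 => [|W /andP[ltW nzW]]; last first.
  rewrite sumE; have /set0Pn[e cute] := cut_pos ltW nzW.
  by rewrite (bigD1 e) //= in_setC cute /= subrr mul0r mulr0.
rewrite addr0 sumE inE expr0 mul1r.
have cut0 : cut set0 = set0 by apply/setP=> e; rewrite !inE.
have [->|neq] := eqVneq x x'.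
  rewrite mulr1n -prodr_const; apply: eq_bigr => e _.
  by rewrite cut0 setC0 in_setT eqxx /= expr1 -opprD.
have [e nxe] : exists e, x e != x' e.
  apply/existsP; apply: contraNT neq; rewrite negb_exists => /forallP H.
  by apply/eqP/ffunP => e; have := H e; rewrite negbK => /eqP.
by rewrite (bigD1 e) //= eq_sym (negPf nxe) andbF subrr mul0r mulr0n.
Qed.

End Tseitin.

(** * Cuts of the de Bruijn graph *)

Lemma sum_double (f : nat -> nat) n :
  \sum_(0 <= i < 2 * n) f i = \sum_(0 <= i < n) (f (2 * i) + f (2 * i).+1).
Proof.
elim: n => [|n IH]; first by rewrite muln0 !big_geq.
by rewrite mulnS addnC addn2 !big_nat_recr //= IH addnA.
Qed.

Lemma sum_split_double (f : nat -> nat) n :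
  \sum_(0 <= i < 2 * n) f i = \sum_(0 <= i < n) (f i + f (i + n)).
Proof.
rewrite big_split /= (@big_cat_nat _ _ _ n) //=; last by rewrite leq_pmull.
congr (_ + _); rewrite mul2n -addnn -{1}[n]add0n big_addn addnK.
by [].
Qed.

Section DeBruijn.
Variable N : nat.

Fact db_src_subproof (e : 'I_(2 * N)) : e./2 < N.
Proof. have := ltn_ord e; lia. Qed.
(** For N = 2^r an edge is a word of r + 1 bits; its source drops the last bit and its target the
    first one. *)
Definition db_src e := Ordinal (db_src_subproof e).

Fact db_tgt_subproof (e : 'I_(2 * N)) : e %% N < N.
Proof. have := ltn_ord e; rewrite ltn_mod; lia. Qed.
Definition db_tgt e := Ordinal (db_tgt_subproof e).

Fact db_inc_subproof (v : 'I_N) (k : 'I_4) :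
  nth 0 [:: 2 * v; (2 * v).+1; val v; v + N] k < 2 * N.
Proof. have := ltn_ord v; case: k => [[|[|[|[|]]]] //= _]; lia. Qed.
Definition db_inc v k := Ordinal (db_inc_subproof v k).

Lemma db_inc_sum (v : 'I_N) (z : 'I_(2 * N) -> nat) :
  \sum_k z (db_inc v k) =
  \sum_(e | db_src e == v) z e + \sum_(e | db_tgt e == v) z e.
Proof.
rewrite !big_ord_recl big_ord0 addn0 addnA.
have ltv := ltn_ord v.
congr (_ + _).
  rewrite (bigD1 (db_inc v ord0)) /=; last by rewrite -val_eqE /=; lia.
  rewrite (bigD1 (db_inc v (lift ord0 ord0))) /=; last first.
    by rewrite -!val_eqE /=; lia.
  rewrite big1 ?addn0 // => e; rewrite -!val_eqE /=; lia.
have tgtE (e : 'I_(2 * N)) : (db_tgt e == v) = (e == v :> nat) || (e == v + N :> nat).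
  rewrite -val_eqE /=; have := ltn_ord e; have [lt _|le lt] := ltnP e N.
    by rewrite modn_small //; lia.
  by rewrite -(subnK le) modnDr modn_small; lia.
rewrite (bigD1 (db_inc v (inord 2))) /=; last first.
  by rewrite tgtE /= inordK //= eqxx.
rewrite (bigD1 (db_inc v (inord 3))) /=; last first.
  by rewrite tgtE -val_eqE /= !inordK //= eqxx orbT; lia.
rewrite big1 => [|e]; last first.
  by rewrite tgtE -!val_eqE /= !inordK //=; lia.
by rewrite addn0; congr (z _ + z _); apply/val_inj; rewrite /= inordK.
Qed.

End DeBruijn.

(* A walk of length [r] from a vertex [u] of the de Bruijn graph on [2 ^ r]    *)
(* vertices ends at a uniformly distributed vertex, and a uniformly random     *)
(* walk crosses each edge equally often at each step.                          *)
Section DeBruijnCut.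
Variables (r : nat) (W : {set 'I_(2 ^ r)}).
Let N := 2 ^ r.

Let N_gt0 : 0 < N. Proof. by rewrite expn_gt0. Qed.

Let w (i : nat) : bool := Ordinal (ltn_pmod i N_gt0) \in W.

Let w_mod i j : i = j %[mod N] -> w i = w j.
Proof. by move=> eq_ij; congr (_ \in W); apply: val_inj. Qed.

Let wE (i : 'I_N) : w i = (i \in W).
Proof. by congr (_ \in W); apply: val_inj; rewrite /= modn_small. Qed.

(** Modulo N, the numbers 2^j u + i with i < 2^j are the ends of the walks of length j from u;
    [walks] counts those whose side of [W] differs from [a]. *)
Let walks (j : nat) (a : bool) (u : nat) : nat :=
  \sum_(0 <= i < 2 ^ j) (a != w (2 ^ j * u + i)).

Let walksS j a u : walks j.+1 a u = walks j a (2 * u) + walks j a (2 * u).+1.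
Proof.
rewrite /walks expnS sum_split_double big_split /=.
by congr (_ + _); apply: eq_bigr => i _; congr (nat_of_bool (_ != w _)); lia.
Qed.

Let walks_le j a u : walks j a u <= 2 ^ j.
Proof.
have -> : 2 ^ j = \sum_(0 <= i < 2 ^ j) 1 by rewrite sum_nat_const_nat subn0 muln1.
by apply: leq_sum => i _; exact: leq_b1.
Qed.

Let walks_diff j a a' u : walks j a u <= walks j a' u + 2 ^ j * (a' != a).
Proof.
have [->|_] := eqVneq a' a; first by rewrite leq_addr.
by rewrite muln1 (leq_trans (walks_le j a u)) // leq_addl.
Qed.

Let walks_period j a u : walks j a (u + N) = walks j a u.
Proof.
apply: eq_bigr => i _; congr (nat_of_bool (_ != _)); apply: w_mod.
by rewrite mulnDr addnAC addnC modnMDl.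
Qed.

Let disagree j := \sum_(0 <= u < N) walks j (w u) u.

Let db_cut : {set 'I_(2 * N)} := cut (@db_src N) (@db_tgt N) W.

Let card_cut : #|db_cut| = \sum_(0 <= e < 2 * N) (w e != w e./2).
Proof.
rewrite big_mkord -sum1_card big_mkcond; apply: eq_bigr => e _.
rewrite inE -!wE /=.
rewrite (@w_mod (e %% N) e) ?modn_mod //.
by case: (w e); case: (w e./2).
Qed.

(** Split off the first edge of the walk and compare the end with the target of that edge instead of
    its source: this changes the count only on cut edges, by at most 2^j each. Every vertex is the
    target of two edges, whence the factor 2. *)
Let disagreeS j : disagree j.+1 <= 2 * disagree j + 2 ^ j * #|db_cut|.
Proof.
have -> : disagree j.+1 = \sum_(0 <= e < 2 * N) walks j (w e./2) e.
  rewrite sum_double; apply: eq_bigr => u _; rewrite walksS.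
  by rewrite mul2n /= doubleK uphalf_double.
have -> : 2 * disagree j = \sum_(0 <= e < 2 * N) walks j (w e) e.
  rewrite sum_split_double big_split mul2n -addnn; congr (_ + _).
  apply: eq_bigr => u _; rewrite walks_period (@w_mod (u + N) u) //.
  by rewrite modnDr.
rewrite card_cut big_distrr -big_split; apply: leq_sum => e _.
exact: walks_diff.
Qed.

Let disagree_le j : 2 * disagree j <= j * 2 ^ j * #|db_cut|.
Proof.
elim: j => [|j IH].
  rewrite !mul0n leqn0 muln_eq0 /= /disagree big1_seq // => u _.
  by rewrite /walks big_nat1 mul1n addn0 eqxx.
have := disagreeS j; rewrite expnS; nia.
Qed.

Let disagree_r : disagree r = 2 * (#|W| * (N - #|W|)).
Proof.
have cardC : N - #|W| = #|~: W| by rewrite [RHS]cardsCs setCK card_ord.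
have cardT a : \sum_(0 <= i < N) (a != w i) = if a then N - #|W| else #|W|.
  rewrite big_mkord; case: a.
    rewrite cardC -sum1_card [RHS]big_mkcond.
    by apply: eq_bigr => i _; rewrite inE wE; case: (_ \in W).
  rewrite -sum1_card [RHS]big_mkcond.
  by apply: eq_bigr => i _; rewrite wE; case: (_ \in W).
have walkE u : walks r (w u) u = if w u then N - #|W| else #|W|.
  rewrite -cardT; apply: eq_bigr => i _; congr (nat_of_bool (_ != _)).
  by apply: w_mod; rewrite mulnC modnMDl.
rewrite /disagree big_mkord (bigID (mem W)) /=.
under eq_bigr => u Wu do rewrite walkE wE Wu.
under [X in _ + X]eq_bigr => u Wu do rewrite walkE wE (negPf Wu).
rewrite !sum_nat_const mul2n -addnn; congr (_ + _).
rewrite mulnC; congr (_ * _); rewrite cardC.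
by apply: eq_card => i; rewrite !inE.
Qed.

Lemma db_cut_card :
  4 * (#|W| * (2 ^ r - #|W|)) <=
  r * 2 ^ r * #|cut (@db_src (2 ^ r)) (@db_tgt (2 ^ r)) W|.
Proof. have := disagree_le r; rewrite disagree_r mulnA; exact. Qed.

End DeBruijnCut.

Lemma db_cut_neq0 r (W : {set 'I_(2 ^ r)}) : 2 * #|W| < 2 ^ r -> W != set0 ->
  cut (@db_src (2 ^ r)) (@db_tgt (2 ^ r)) W != set0.
Proof.
move=> ltW; rewrite -!card_gt0 => W_gt0.
by have := db_cut_card W; case: #|cut _ _ _| => //; nia.
Qed.

Lemma db_cut_balanced r (W : {set 'I_(2 ^ r)}) v : 1 < r ->
  2 * #|W| < 2 ^ r -> 2 ^ r <= 2 * #|toggle v W| ->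
  (2 ^ r).-2 %/ r < #|cut (@db_src (2 ^ r)) (@db_tgt (2 ^ r)) W|.
Proof.
case: r W v => [|[|r]] // W v _ ltW leW.
have := db_cut_card W; have := card_toggle v W.
rewrite ltn_divLR //.
set c := #|cut _ _ _|.
move: ltW leW; set T := #|toggle v W|; set k := #|W|; clearbody c T k.
have := expn_gt0 2 r; rewrite !expnS; move: (2 ^ r) => M M_gt0.
move=> ltW leW leT.
(* Here N = 4 M is even, which forces |W| = N / 2 - 1. The cut bound then reads N^2 - 4 <= r N c,
   and N >= 4 gives N - 1 <= r c. *)
have -> : k = 2 * M - 1 by lia.
move=> le.
have : 2 * (2 * M) * (2 * (2 * M) - 1) <= 2 * (2 * M) * (c * r.+2) by nia.
rewrite leq_pmul2l; nia.
Qed.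

(** * From Tseitin constraints to cliques *)

(* [(1 + 1/q) ^ j <= q / (q - j)] *)
Lemma expn_succ_mulB q j : j <= q -> q.+1 ^ j * (q - j) <= q ^ j.+1.
Proof.
elim: j => [|j IH] ltj; first by rewrite subn0 mul1n.
have := IH (ltnW ltj); rewrite !expnSr.
move: (q.+1 ^ j) (q ^ j) => a c le.
have -> : a * q.+1 * (q - j.+1) = a * (q.+1 * (q - j.+1)) by rewrite mulnA.
apply: leq_trans (_ : a * ((q - j) * q) <= _).
  by rewrite leq_mul2l; apply/orP; right; nia.
by rewrite mulnA leq_mul2r le orbT.
Qed.

Lemma expn_succ_double p : 0 < p -> (2 * p).+1 ^ p <= 2 * (2 * p) ^ p.
Proof.
move=> p_gt0; have := @expn_succ_mulB (2 * p) p (leq_pmull p (ltn0Sn 1)).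
have -> : 2 * p - p = p by lia.
by rewrite expnS -[2 * p * _]mulnA [p * _]mulnC mulnA leq_pmul2r.
Qed.

Lemma leq_expr2 m n e : m <= n -> m ^ e <= n ^ e.
Proof. by case: e => // e; rewrite leq_exp2r. Qed.

(** An exponential moment bound: expand (b + c)^|E| over subsets S; each S counted on the left
    carries the weight c^|~: S| >= c^g. *)
Lemma sum_large_compl (E : finType) (b c g : nat) : 0 < c ->
  c ^ g * (\sum_(S : {set E} | g <= #|~: S|) b ^ #|S|) <= (b + c) ^ #|E|.
Proof.
move=> c_gt0.
have -> : (b + c) ^ #|E| = \sum_(S : {set E}) b ^ #|S| * c ^ #|~: S|.
  rewrite -prod_nat_const bigA_distr; apply: eq_bigr => S _.
  rewrite (bigID (mem S)) /= -!prod_nat_const; congr (_ * _).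
    by apply: eq_bigr => e ->.
  by apply: eq_big => [e|e /negPf -> //]; rewrite inE.
rewrite big_distrr /= [leqRHS](bigID (fun S : {set E} => g <= #|~: S|)) /=.
apply: leq_trans (leq_addr _ _); apply: leq_sum => S leg.
by rewrite mulnC leq_mul2l leq_pexp2l // orbT.
Qed.

(** With q = 2p, b = 8q and c = 8, the moment bound loses (1 + 1/q)^|E| <= (1 + 1/q)^(q g) <= 4^g
    and gains 8^g. *)
Lemma rank_gap (E : finType) p g : 0 < p -> #|E| <= 2 * p * g ->
  2 ^ g * (\sum_(S : {set E} | g <= #|~: S|) (8 * (2 * p)) ^ #|S|)
    <= (8 * (2 * p)) ^ #|E|.
Proof.
move=> p_gt0 leE; set q := 2 * p; set K := \sum_(S | _) _.
have q_gt0 : 0 < q by rewrite muln_gt0.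
have le1 : q.+1 ^ #|E| <= 4 ^ g * q ^ #|E|.
  rewrite -(@leq_pmul2r (q ^ (q * g - #|E|))) ?expn_gt0 ?q_gt0 //.
  rewrite -mulnA -expnD subnKC //.
  apply: leq_trans (_ : q.+1 ^ (q * g) <= _).
    by rewrite -{2}(subnKC leE) expnD leq_mul2l leq_expr2 ?leqnSn ?orbT.
  have -> : q * g = p * (2 * g) by rewrite /q; lia.
  rewrite (expnM q.+1) (expnM q) (_ : 4 ^ g = 2 ^ (2 * g)); last by rewrite expnM.
  rewrite -expnMn.
  exact/leq_expr2/expn_succ_double.
have := @sum_large_compl E (8 * q) 8 g isT; rewrite -/K => le2.
rewrite -(@leq_pmul2l (4 ^ g)) ?expn_gt0 // mulnA -expnMn.
apply: leq_trans le2 _; rewrite -mulnSr !(expnMn 8) mulnCA leq_mul2l.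
by rewrite le1 orbT.
Qed.

(** * Cliques of compatible local assignments *)

Section TseitinClique.
Variables (V E : finType) (src tgt : E -> V) (v0 : V).
Variables (d : nat) (inc : V -> 'I_d -> E).
Hypothesis inc_sum : forall v (z : E -> nat),
  \sum_k z (inc v k) = \sum_(e | src e == v) z e + \sum_(e | tgt e == v) z e.
Variable b : nat.

Notation X := {ffun E -> 'I_b}.
Notation Y := {ffun E -> option 'I_b}.

Definition local_assignment : finType := (V * {ffun 'I_d -> 'I_b})%type.

Definition restrict (x : X) (v : V) : local_assignment :=
  (v, [ffun k => x (inc v k)]).

Definition local_sat (y : Y) (q : local_assignment) : bool :=
  odd (\sum_k (y (inc q.1 k) == Some (q.2 k))) == (q.1 == v0).

Definition assignment_clique (x : X) : {set local_assignment} :=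
  [set restrict x v | v : V].

Definition consistent_sat (y : Y) (A : {set local_assignment}) : bool :=
  [forall q in A, local_sat y q] && [exists x, A \subset assignment_clique x].

Lemma card_assignment_clique x : #|assignment_clique x| = #|V|.
Proof. by rewrite card_imset // => v v' []. Qed.

Lemma assignment_cliqueE x q :
  q \in assignment_clique x -> q = restrict x q.1.
Proof. by case/imsetP=> v _ ->. Qed.

(** A clique has at most one local assignment per constraint. With one at each, they glue to a
    global [x] satisfying every constraint; but the degrees sum to an even number, while only [v0]
    has odd degree. *)
Lemma consistent_sat_small y (S : {set local_assignment}) : 1 < #|V| ->
  {in S &, forall q q', q != q' -> consistent_sat y [set q; q']} ->
  #|S| < #|V|.
Proof.
move=> V_gt1 cliqueS; rewrite ltnNge; apply/negP => leVS.
have cons q q' : q \in S -> q' \in S -> q != q' ->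
    local_sat y q /\ exists x, q = restrict x q.1 /\ q' = restrict x q'.1.
  move=> Sq Sq' /(cliqueS _ _ Sq Sq')/andP[/'forall_implyP satA].
  case/existsP=> x; rewrite subUset !sub1set => /andP[qx q'x].
  split; first by apply: satA; rewrite !inE eqxx.
  by exists x; split; apply: assignment_cliqueE.
have fst_inj : {in S &, injective (fun q : local_assignment => q.1)}.
  move=> q q' Sq Sq' eq1; apply: contraTeq isT => neq.
  have [_ [x [qE q'E]]] := cons _ _ Sq Sq' neq.
  by move: neq; rewrite qE q'E /= eq1 eqxx.
have [p pS] : exists p : V -> local_assignment, forall v, p v \in S /\ (p v).1 = v.
  apply: (@fin_all_exists _ _ (fun v q => q \in S /\ q.1 = v)) => v.
  have : v \in [set q.1 | q in S].
    suff -> : [set q.1 | q in S] = [set: V] by rewrite inE.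
    by apply/eqP; rewrite eqEcard subsetT cardsT card_in_imset.
  by case/imsetP=> q Sq ->; exists q.
have other (v : V) : exists v' : V, v' != v.
  have [v' neq|allv] := pickP (fun v' => v' != v); first by exists v'.
  suff : #|V| <= 1 by rewrite leqNgt V_gt1.
  rewrite -cardsT -(cards1 v) subset_leq_card //; apply/subsetP => u _.
  by have := allv u; rewrite inE => /negbFE.
have p_neq (v v' : V) : v' != v -> p v' != p v.
  by apply: contraNneq => eqp; rewrite -(proj2 (pS v)) -eqp (proj2 (pS v')).
have p_sat v : local_sat y (p v).
  have [v' /p_neq neq] := other v; rewrite eq_sym in neq.
  by have [] := cons _ _ (proj1 (pS v)) (proj1 (pS v')) neq.
have p_cons v v' : exists x : X, p v = restrict x v /\ p v' = restrict x v'.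
  have key (u u' : V) : u' != u ->
      exists x : X, p u = restrict x u /\ p u' = restrict x u'.
    move=> /p_neq neq; rewrite eq_sym in neq.
    have [_] := cons _ _ (proj1 (pS u)) (proj1 (pS u')) neq.
    by rewrite (proj2 (pS u)) (proj2 (pS u')).
  have [->|neq] := eqVneq v' v; last exact: key.
  by have [u /key[x [pv _]]] := other v; exists x.
have [x xE] : exists x : E -> 'I_b,
    forall e v k, inc v k = e -> (p v).2 k = x e.
  apply: (@fin_all_exists _ _
    (fun e i => forall v k, inc v k = e -> (p v).2 k = i)) => e.
  have [k eE] : exists k, inc (src e) k = e.
    apply/'exists_eqP; apply: contraT; rewrite negb_exists => /forallP nE.
    have := inc_sum (src e) (fun e' => e' == e).
    rewrite big1 => [|k _]; last by rewrite (negPf (nE k)).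
    by rewrite (bigD1 e) //= eqxx.
  (* The value on [e] is read at its source; pairwise consistency makes every other reading
     agree. *)
  exists ((p (src e)).2 k) => v k' eE'.
  have [x [-> ->]] := p_cons v (src e).
  by rewrite !ffunE eE eE'.
pose z e : nat := y e == Some (x e).
have zE v : odd (\sum_k z (inc v k)) = (v == v0).
  have := p_sat v; rewrite /local_sat (proj2 (pS v)) => /eqP <-.
  by congr odd; apply: eq_bigr => k _; rewrite (xE _ _ _ erefl).
have /(congr1 odd) : \sum_v \sum_k z (inc v k) = (\sum_e z e) + (\sum_e z e).
  rewrite (eq_bigr _ (fun v _ => inc_sum v z)) big_split /=; congr (_ + _).
    by rewrite [RHS](partition_big src predT).
  by rewrite [RHS](partition_big tgt predT).
rewrite oddD addbb (bigD1 v0) //= oddD zE eqxx /=.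
suff -> : odd (\sum_(v | v != v0) \sum_k z (inc v k)) = false by [].
elim/big_ind: _ => // [i j oi oj|v /negPf nv]; first by rewrite oddD oi oj.
by rewrite zE.
Qed.

End TseitinClique.

(** * Embedding into [CLIQUE] under a uniform orientation *)

(** Where [beta] is 0, both copies of a variable in the oriented pair grow with it, so f is monotone
    in the edges inside [U]. *)
Lemma orientation_homo n (beta : cube (edge n)) (U : {set 'I_n}) f
    (x y : cube (edge n)) :
  has_orientation beta f ->
  (forall e : edge n, val e \subset U -> beta e = false) ->
  (forall e, x e -> y e) ->
  (forall e : edge n, ~~ (val e \subset U) -> x e = y e) ->
  f x -> f y.
Proof.
move=> [h h_mono fE] betaU lexy eqxy; rewrite !fE; apply: h_mono => -[] e.
  by rewrite !ffunE; apply: lexy.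
rewrite !ffunE; have [sub|nsub] := boolP (val e \subset U).
  by rewrite betaU // !addbF; apply: lexy.
by rewrite eqxy.
Qed.

Section EmbeddedGraph.
Variables (n : nat) (T : finType) (emb : T -> 'I_n) (D : {set 'I_n}).
Hypothesis emb_inj : injective emb.
Hypothesis embD : [disjoint emb @: [set: T] & D].

(* The vertices of [D] are joined to each other and to all the embedded ones;  *)
(* the remaining vertices are isolated.                                        *)
Definition embedded_graph (h : {set T} -> bool) : cube (edge n) :=
  [ffun e : edge n => if val e \subset emb @: [set: T] then h (emb @^-1: val e)
             else val e \subset emb @: [set: T] :|: D].

Lemma embedded_graph_clique (h : {set T} -> bool) (K : {set T}) :
  (forall A : {set T}, A \subset K -> h A) ->
  clique (#|K| + #|D|) (embedded_graph h).
Proof.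
move=> hK; apply/existsP; exists (emb @: K :|: D); apply/andP; split.
  rewrite cardsU card_imset // (_ : emb @: K :&: D = set0) ?cards0 ?subn0 //.
  apply/eqP; rewrite setI_eq0; apply: disjointWl embD; exact: imsetS (subsetT _).
apply/forallP => e; apply/implyP => sube; rewrite ffunE.
case: ifP => [subT|_]; last first.
  by apply: subset_trans sube _; rewrite setSU // imsetS // subsetT.
apply: hK; apply/subsetP => q; rewrite inE => qe.
have := subsetP sube _ qe; rewrite inE mem_imset // => /orP[//|qD].
by have := disjointFr embD (imset_f emb (in_setT q)); rewrite qD.
Qed.

Lemma embedded_graph_clique_size (h : {set T} -> bool) (m : nat) : 1 < m ->
  clique m (embedded_graph h) ->
  exists2 S : {set T}, m <= #|S| + #|D| &
    {in S &, forall q q', q != q' -> h [set q; q']}.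
Proof.
move=> m_gt1 /existsP[S /andP[/eqP cardS /forallP edgeS]].
have edgeP a a' : a \in S -> a' \in S -> a != a' ->
    exists2 e : edge n, val e = [set a; a'] & embedded_graph h e.
  move=> Sa Sa' neq; have c2 : #|[set a; a']| == 2 by rewrite cards2 neq.
  exists (exist _ [set a; a'] c2) => //.
  by apply: (implyP (edgeS _)); rewrite /= subUset !sub1set Sa.
exists (emb @^-1: S) => [|q q']; last first.
  rewrite !inE => Sq Sq' neq.
  have [|e eE] := edgeP _ _ Sq Sq'; first by rewrite inj_eq.
  rewrite ffunE eE subUset !sub1set !imset_f //=.
  suff -> : emb @^-1: [set emb q; emb q'] = [set q; q'] by [].
  by apply/setP=> p; rewrite !inE !(inj_eq emb_inj).
(* Since m > 1, every vertex of the clique has an edge, so none of them is isolated. *)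
have subS : S \subset emb @: (emb @^-1: S) :|: D.
  apply/subsetP => a Sa; have : 1 < #|S| by rewrite cardS.
  case/card_gt1P => a1 [a2 [Sa1 Sa2 neq12]].
  have [a' Sa' neq] : exists2 a', a' \in S & a != a'.
    by have [eq1|neq1] := eqVneq a a1; [exists a2; rewrite ?eq1|exists a1].
  have [e eE] := edgeP _ _ Sa Sa' neq; rewrite ffunE eE !subUset !sub1set.
  have emb_pre c : c \in S -> c \in emb @: [set: T] -> c \in emb @: (emb @^-1: S).
    by move=> Sc /imsetP[q _ cE]; rewrite cE imset_f // inE -cE.
  case: ifP => [/andP[aT _] _|_].
    by rewrite inE emb_pre.
  case/andP; rewrite !inE => /orP[aT _|-> _]; last by rewrite orbT.
  by rewrite emb_pre.
rewrite -cardS; apply: leq_trans (subset_leq_card subS) _.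
by rewrite -(card_imset (emb @^-1: S) emb_inj) leq_card_setU.
Qed.

(** This supplies the comparison input [bot] that controls the negation gates. *)
Lemma embedded_graph_bot (U : {set 'I_n}) h beta f :
  emb @: [set: T] \subset U -> has_orientation beta f ->
  (forall e : edge n, val e \subset U -> beta e = false) ->
  f (embedded_graph (fun=> false)) -> f (embedded_graph h).
Proof.
move=> subU fbeta betaU; apply: (orientation_homo fbeta betaU) => e.
  by rewrite !ffunE; case: ifP.
by rewrite !ffunE; case: ifP => // /subset_trans/(_ subU) ->.
Qed.

End EmbeddedGraph.

Lemma exists_embedding n (U : {set 'I_n}) (T : finType) : #|T| <= #|U| ->
  exists2 emb : T -> 'I_n, injective emb & emb @: [set: T] \subset U.
Proof.
move=> leTU; exists (fun q => enum_val (widen_ord leTU (enum_rank q))).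
  by move=> q q' /enum_val_inj/(congr1 val)/= /val_inj/enum_rank_inj.
by apply/subsetP => a /imsetP[q _ ->]; apply: enum_valP.
Qed.

Lemma exists_disjoint n (A : {set 'I_n}) m : m + #|A| <= n ->
  exists2 D : {set 'I_n}, #|D| = m & [disjoint A & D].
Proof.
move=> le; have : m <= #|~: A| by rewrite cardsCs setCK card_ord; lia.
case/(@card_geqP _ _ _) => s [us <- sA]; exists [set a in s].
  by rewrite cardsE; apply/card_uniqP.
rewrite disjoint_sym disjoint_subset; apply/subsetP => a; rewrite !inE => /sA.
by rewrite inE.
Qed.

Theorem clique_depth n (C : circuit (edge n)) (beta : cube (edge n))
    (U : {set 'I_n}) r :
  1 < r ->
  computes C (@CLIQUE n) -> uniform_orientation C beta ->
  (forall e : edge n, val e \subset U -> beta e = false) ->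
  2 ^ r * (32 * r) ^ 4 <= #|U| -> 2 * (2 ^ r * (32 * r) ^ 4) <= n ->
  2 ^ r <= r * (depth C).+1 + 1.
Proof.
move=> r_gt1 C_clique C_beta betaU leU len.
set N := 2 ^ r in leU len *; set b := 32 * r.
have N_ge4 : 4 <= N by rewrite -[4]/(2 ^ 2) leq_exp2l.
have b_gt0 : 0 < b by rewrite /b; lia.
have N_gt0 : 0 < N by lia.
pose v0 : 'I_N := Ordinal N_gt0.
pose inc := @db_inc N.
pose T := local_assignment 'I_N 4 b.
have cardT : #|{: T}| = N * b ^ 4.
  by rewrite card_prod card_ffun !card_ord.
have leN : N <= N * b ^ 4 by rewrite leq_pmulr // expn_gt0 b_gt0.
have [|emb emb_inj embU] := @exists_embedding n U T; first by rewrite cardT.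
have cardI : #|emb @: [set: T]| = N * b ^ 4.
  by rewrite card_imset // cardsT cardT.
have [|D cardD disjD] := @exists_disjoint n (emb @: [set: T]) (n./2 - N).
  rewrite cardI; lia.
(* Padding by [D] turns cliques of size N among the local assignments into cliques of size n/2. *)
have half : n./2 = N + #|D| by rewrite cardD; lia.
pose G (x : {ffun 'I_(2 * N) -> 'I_b}) :=
  embedded_graph emb D (fun A => A \subset assignment_clique inc x).
pose H (y : {ffun 'I_(2 * N) -> option 'I_b}) :=
  embedded_graph emb D (consistent_sat v0 inc y).
pose f := tseitin_mx (@db_src N) (@db_tgt N) v0 (b := b).
pose g := (N.-2 %/ r).+1.
pose K := \sum_(S : {set 'I_(2 * N)} | g <= #|~: S|) b ^ #|S|.
have cut_large (W : {set 'I_N}) v : 2 * #|W| < #|'I_N| ->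
    #|'I_N| <= 2 * #|toggle v W| -> g <= #|cut (@db_src N) (@db_tgt N) W|.
  by rewrite card_ord; apply: db_cut_balanced.
have cut_pos (W : {set 'I_N}) : 2 * #|W| < #|'I_N| -> W != set0 ->
    cut (@db_src N) (@db_tgt N) W != set0.
  by rewrite card_ord; apply: db_cut_neq0.
have botP h j : j < size (gates C) ->
    node_fun C j (embedded_graph emb D (fun=> false)) ->
    node_fun C j (embedded_graph emb D h).
  move=> ltj.
  exact: (@embedded_graph_bot n T emb D U h beta _ embU (C_beta j ltj) betaU).
have leK : b ^ (2 * N) <= 2 ^ depth C * (2 * K).
  apply: leq_trans (_ : rect_rank f [set: _] [set: _] <= _).
    by rewrite -{1}(card_ord (2 * N)); apply: tseitin_rank_full.
  apply: (measure_depth (G := G) (H := H)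
           (bot := embedded_graph emb D (fun=> false))).
  - exact: rect_rank0l.
  - exact: rect_rank0r.
  - exact: rect_rankDl.
  - exact: rect_rankDr.
  - move=> e P Q GP HQ.
    have [->|[x0 Px0]] := set_0Vmem P; first by rewrite rect_rank0l.
    have [->|[y0 Qy0]] := set_0Vmem Q; first by rewrite rect_rank0r.
    have [sub|nsub] := boolP (val e \subset emb @: [set: T]); last first.
      by have := HQ y0 Qy0; have := GP x0 Px0; rewrite !ffunE (negPf nsub) => ->.
    have [q [q' eE]] : exists q q', emb @^-1: val e = [set q; q'].
      have /cards2P[a [a' [_ eE]]] := valP e.
      move: sub; rewrite eE subUset !sub1set.
      case/andP=> /imsetP[q _ ->] /imsetP[q' _ ->]; exists q, q'.
      by apply/setP=> p; rewrite !inE !(inj_eq emb_inj).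
    have PE x : x \in P -> q = restrict inc x q.1 /\ q' = restrict inc x q'.1.
      move=> /GP; rewrite ffunE sub eE subUset !sub1set.
      by case/andP=> /assignment_cliqueE qE /assignment_cliqueE q'E.
    (* The pair is consistent, as [x0] shows, so its absence from the graph of [y] can only come
       from an unsatisfied constraint at [q] or [q']; splitting [Q] accordingly costs the factor 2
       in [2 * K]. *)
    have QE y : y \in Q -> local_sat v0 inc y q -> ~~ local_sat v0 inc y q'.
      move=> /HQ; rewrite ffunE sub eE => nsat satq; apply: contra nsat => satq'.
      apply/andP; split; first by apply/forall_inP => p /set2P[] ->.
      apply/existsP; exists x0; have := GP x0 Px0.
      by rewrite ffunE sub eE.
    have viol p x y : p = restrict inc x p.1 -> ~~ local_sat v0 inc y p ->
        odd (\sum_k hit x y (inc p.1 k)) != (p.1 == v0).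
      move=> pE; rewrite /local_sat; congr (odd _ != _).
      by apply: eq_bigr => k _; rewrite pE /= ffunE.
    pose Q' := [set y | ~~ local_sat v0 inc y q].
    apply: leq_trans (rect_rankDr _ _ _ Q') _; rewrite [2 * K]mul2n -[K.*2]addnn.
    apply: leq_add.
      apply: (tseitin_rank_violated (@db_inc_sum N) cut_large (v := q.1)).
      move=> x y Px; rewrite !inE => /andP[_ nsat].
      by apply: viol nsat; have [] := PE x Px.
    apply: (tseitin_rank_violated (@db_inc_sum N) cut_large (v := q'.1)).
    move=> x y Px; rewrite !inE negbK => /andP[satq Qy].
    by apply: viol (QE _ Qy satq); have [] := PE x Px.
  - by move=> j x ltj; apply: botP.
  - by move=> j y ltj; apply: botP.
  - move=> x; rewrite C_clique /CLIQUE half.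
    rewrite -{1}(card_ord N) -(card_assignment_clique inc x).
    by apply: embedded_graph_clique.
  - move=> y; rewrite C_clique /CLIQUE half; apply/negP.
    have N_gt1 : 1 < N + #|D| by lia.
    case/(embedded_graph_clique_size emb_inj N_gt1) => S leS cliqueS.
    have : #|S| < #|'I_N|.
      apply: (consistent_sat_small (@db_inc_sum N) _ cliqueS).
      by rewrite card_ord; lia.
    by rewrite card_ord ltnNge -(leq_add2r #|D|) leS.
(* [rank_gap] is applied with p = 2r; its requirement 2N <= 4 r g follows from g r >= N - 1. *)
have bE : b = 8 * (2 * (2 * r)) by rewrite /b; lia.
have r_gt0 : 0 < r by lia.
have g_r : N.-2 < g * r by rewrite /g -ltn_divLR.
have gapP : #|'I_(2 * N)| <= 2 * (2 * r) * g by rewrite card_ord; nia.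
have := @rank_gap 'I_(2 * N) (2 * r) g _ gapP.
rewrite -bE -/K card_ord => /(_ _)/leq_trans/(_ leK).
rewrite mulnA -expnSr leq_pmul2r; last first.
  rewrite /K (bigD1 set0) /=.
    by rewrite cards0 expn0.
  rewrite setC0 cardsT card_ord /g.
  have := leq_div N.-2 r; lia.
rewrite leq_exp2l // => le.
have le_g : g <= (depth C).+1 by apply: le; lia.
by have := leq_trans g_r (leq_mul le_g (leqnn r)); rewrite mulnC; lia.
Qed.

(** * Asymptotics *)

From mathcomp Require Import all_classical all_reals all_analysis.
From mathcomp Require Import ring lra.

Import numFieldNormedType.Exports.
Local Open Scope classical_set_scope.
Local Open Scope ring_scope.

Lemma expR_dominates_monomial (R : realType) (j : nat) (c a : R) : 0 < a ->
  exists x0 : R, forall x, x0 <= x -> c * x ^+ j <= expR (a * x).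
Proof.
move=> a_gt0; exists (`|c| * (j.+1)`!%:R / a ^+ j.+1) => x lex.
have x_ge0 : 0 <= x.
  by apply: le_trans lex; rewrite divr_ge0 ?mulr_ge0 ?exprn_ge0 // ltW.
have := expR_ge1Dxn j (mulr_ge0 (ltW a_gt0) x_ge0).
apply: le_trans; apply: ler_wpDl => //.
apply: le_trans (_ : `|c| * x ^+ j <= _).
  by rewrite ler_wpM2r ?exprn_ge0 // ler_norm.
rewrite ler_pdivrMr ?exprn_gt0 // in lex.
rewrite ler_pdivlMr ?ltr0n ?fact_gt0 // mulrAC exprMn [x ^+ j.+1]exprS mulrA.
by rewrite [a ^+ _ * x]mulrC ler_wpM2r // exprn_ge0.
Qed.

Section Growth.
Variable R : realType.

Let ln2_gt0 : 0 < ln (2 : R). Proof. by rewrite ln_gt0 // ltr1n. Qed.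

Let exp2E (r : nat) : (2 ^ r)%:R = expR (ln 2 * r%:R) :> R.
Proof. by rewrite expRM_natr lnK ?posrE // natrX. Qed.

(** Put x = r + 1. For large r the factor (32 x)^4 is at most 2^(d2 x), so t^theta <= 2^((1 - d1)
    x), while D is at least about 2^x / (2 x). The remaining 2^(d1 x) outgrows any multiple of x, in
    particular the one that 1 / M calls for. *)
Lemma powR_le_depth (theta M : R) : 0 < theta < 1 -> 0 < M ->
  exists r0 : nat, forall (r D : nat) (t : R), (r0 <= r)%N ->
    0 <= t < (2 ^ r.+1 * (32 * r.+1) ^ 4)%:R ->
    (2 ^ r <= r * D.+1 + 1)%N ->
    t `^ theta <= M * D%:R.
Proof.
move=> /andP[th_gt0 th_lt1] M_gt0.
(* Chosen so that theta (1 + d2) = 1 - d1, both positive. *)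
pose d1 := (1 - theta) / 2; pose d2 := (1 - theta) / (2 * theta).
have d1_gt0 : 0 < d1 by rewrite divr_gt0 // subr_gt0.
have d2_gt0 : 0 < d2 by rewrite divr_gt0 ?subr_gt0 ?mulr_gt0.
have thE : theta * (1 + d2) = 1 - d1.
  by rewrite /d1 /d2; field; rewrite gt_eqF.
have [x1 Hx1] := @expR_dominates_monomial R 4 (32 ^+ 4) (d2 * ln 2)
  (mulr_gt0 d2_gt0 ln2_gt0).
have [x2 Hx2] := @expR_dominates_monomial R 1 (4 + 2 / M) (d1 * ln 2)
  (mulr_gt0 d1_gt0 ln2_gt0).
exists (maxn (Num.truncn x1).+1 (Num.truncn x2).+1) => r D t.
rewrite geq_max => /andP[ltr1 ltr2] /andP[t_ge0 ltt] leD.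
pose x : R := r.+1%:R.
have lex (z : R) : ((Num.truncn z).+1 <= r)%N -> z <= x.
  move=> le; apply: ltW; apply: lt_le_trans (truncnS_gt z) _.
  by rewrite ler_nat; apply: leqW.
have x_gt0 : 0 < x by rewrite ltr0n.
have {Hx1} := Hx1 x (lex _ ltr1); have {Hx2} := Hx2 x (lex _ ltr2).
set P := expR (d1 * _ * x); rewrite expr1 => leP le4.
pose Q := expR ((1 - d1) * (ln 2 * x)).
have PQ : (2 ^ r.+1)%:R = P * Q by rewrite exp2E -expRD; congr expR; ring.
have leQ : t `^ theta <= Q.
  apply: le_trans (_ : expR ((1 + d2) * (ln 2 * x)) `^ theta <= _).
    apply: ge0_ler_powR; rewrite ?nnegrE ?expR_ge0 ?(ltW th_gt0) //.
    apply: le_trans (ltW ltt) _; rewrite natrM exp2E mulrDl mul1r expRD.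
    rewrite ler_wpM2l ?expR_ge0 // natrX natrM exprMn.
    by rewrite [d2 * (_ * _)]mulrA.
  rewrite /powR gt_eqF ?expR_gt0 // expRK /Q mulrA thE //.
have Q_ge1 : 1 <= Q.
  by rewrite -expR0 ler_expR !mulr_ge0 ?ltW //; rewrite /d1; lra.
have leD' : (2 ^ r.+1)%:R <= 2 * x * (D%:R + 2).
  rewrite -[2 * x]natrM -natrD -natrM ler_nat expnS; nia.
rewrite PQ in leD'.
have : (4 + 2 / M) * x * Q <= 2 * x * (D%:R + 2).
  by apply: le_trans leD'; rewrite ler_wpM2r // expR_ge0.
rewrite [leLHS](_ : _ = 2 * x * ((2 + M^-1) * Q)); last first.
  by field; rewrite gt_eqF.
rewrite ler_pM2l ?mulr_gt0 // => le; apply: le_trans leQ _.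
have : M^-1 * Q <= D%:R by lra.
by rewrite ler_pdivrMl.
Qed.

Lemma log2_unbounded (x : R) : \forall n \near \oo, x <= log2 R n.
Proof.
exists (Num.truncn (expR (ln 2 * x))).+1 => // n /= len.
rewrite /log2 ler_pdivlMr // mulrC.
have lt_n : expR (ln 2 * x) <= n%:R.
  by apply: ltW; apply: lt_le_trans (truncnS_gt _) _; rewrite ler_nat.
have n_gt0 : 0 < n%:R :> R by apply: lt_le_trans lt_n; apply: expR_gt0.
by rewrite -ler_expR lnK ?posrE.
Qed.

Lemma powR_log2_le (q : R) : \forall n \near \oo, 2 * log2 R n `^ q <= n%:R.
Proof.
pose j := (Num.truncn q).+1.
have [x0 Hx0] := @expR_dominates_monomial R j 2 (ln 2) ln2_gt0.
near=> n.
have L_ge1 : 1 <= log2 R n by near: n; apply: log2_unbounded.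
have L_ge : x0 <= log2 R n by near: n; apply: log2_unbounded.
have n_gt0 : 0 < n%:R :> R by rewrite ltr0n; near: n; exists 1.
have -> : n%:R = expR (ln 2 * log2 R n).
  by rewrite /log2 mulrCA divff ?gt_eqF // mulr1 lnK ?posrE.
apply: le_trans (Hx0 _ L_ge); rewrite ler_pM2l // -powR_mulrn ?(le_trans ler01) //.
by apply: ler_powR => //; apply/ltW/truncnS_gt.
Unshelve. all: by end_near.
Qed.

End Growth.

Lemma exists_last_le (R : realType) (m : nat -> nat) (r0 : nat) (t : R) :
  (forall r, (r <= m r)%N) -> (m r0)%:R <= t ->
  exists r, [/\ (r0 <= r)%N, (m r)%:R <= t & t < (m r.+1)%:R].
Proof.
move=> le_m le0.
(* [m] need not be monotone: the least such r works, its minimality giving [m r <= t]. *)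
have ex : exists r, (r0 <= r)%N && (t < (m r.+1)%:R).
  exists (maxn r0 (Num.truncn t)); rewrite leq_maxl /=.
  apply: lt_le_trans (truncnS_gt t) _; rewrite ler_nat.
  by apply: leq_trans (le_m _); rewrite ltnS leq_maxr.
case: (ex_minnP ex) => r /andP[ler lt] rmin; exists r; split=> //.
have [<- //|neq] := eqVneq r0 r.
have r_gt0 : (r0 < r)%N by rewrite ltn_neqAle neq.
rewrite leNgt; apply/negP => ltr.
have := rmin r.-1; rewrite prednK ?(leq_ltn_trans _ r_gt0) // ltr andbT; lia.
Qed.

Theorem theorem6 (R : realType) (k eps : R) (hk : 1 <= k) (heps : 0 < eps)
  (C : forall n : nat, circuit (edge n)) (beta : forall n : nat, cube (edge n))
  (hC : \forall n \near \oo,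
    [/\ computes (C n) (@CLIQUE n),
        uniform_orientation (C n) (beta n)
      & exists U : {set 'I_n},
          log2 R n `^ (k + eps) <= #|U|%:R /\
          (forall e : edge n, val e \subset U -> beta n e = false)]) :
  littleomega (fun n => (depth (C n))%:R) (fun n => log2 R n `^ k).
Proof.
apply/eqoP => M M_gt0.
have k_gt0 : 0 < k by apply: lt_le_trans hk.
have q_gt0 : 0 < k + eps by rewrite addr_gt0.
have theta01 : 0 < k / (k + eps) < 1.
  by rewrite divr_gt0 // ltr_pdivrMr // mul1r ltrDl.
(* With theta = k / (k + eps), raising log^(k + eps) n to the power theta gives log^k n. *)
have [r0 Hr0] := powR_le_depth theta01 M_gt0.
pose m r : nat := (2 ^ r * (32 * r) ^ 4)%N.
have le_m r : (r <= m r)%N.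
  case: r => // r; rewrite -[leqLHS]mul1n leq_mul ?expn_gt0 //.
  apply: (@leq_trans (32 * r.+1)); first exact: leq_pmull.
  by rewrite -[leqLHS]expn1 leq_pexp2l.
pose r1 := maxn r0 2.
near=> n; rewrite !ger0_norm ?powR_ge0 ?ler0n //.
have [C_clique C_beta [U [leU betaU]]] : [/\ computes (C n) (@CLIQUE n),
    uniform_orientation (C n) (beta n) & exists U : {set 'I_n},
      log2 R n `^ (k + eps) <= #|U|%:R /\
      (forall e : edge n, val e \subset U -> beta n e = false)] by near: n.
have len : 2 * log2 R n `^ (k + eps) <= n%:R by near: n; apply: powR_log2_le.
have L_ge : (m r1)%:R <= log2 R n by near: n; apply: log2_unbounded.
have L_ge1 : 1 <= log2 R n by near: n; apply: log2_unbounded.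
(* The size [m r] is fitted to [t] rather than to [#|U|]: [t] is at most [#|U|], and also at most n
   / 2, which leaves room for the padding. *)
set t := log2 R n `^ (k + eps) in leU len.
have let1 : (m r1)%:R <= t.
  apply: le_trans L_ge _; rewrite -[leLHS]powRr1 ?(le_trans ler01) //.
  by apply: ler_powR => //; lra.
have [r [ler1 lemt ltmt]] := exists_last_le le_m let1.
move: ler1; rewrite geq_max => /andP[ler0 r_gt1].
have := @clique_depth n (C n) (beta n) U r r_gt1 C_clique C_beta betaU.
rewrite -/(m r) -2!(ler_nat R) natrM => /(_ (le_trans lemt leU)).
have leD : 2%:R * (m r)%:R <= n%:R :> R.
  by apply: le_trans len; rewrite ler_pM2l.
move=> /(_ leD) le_depth.
have := Hr0 r (depth (C n)) t ler0 _ le_depth; rewrite powR_ge0 ltmt.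
move=> /(_ isT); rewrite /t -powRrM mulrCA divff ?mulr1 //.
by rewrite gt_eqF.
Unshelve. all: by end_near.
Qed.
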